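(* Let $m\ge n\ge 1$, let $A\in\mathbb{C}^{m\times m}$ and $B\in\mathbb{C}^{n\times n}$ be normal matrices, and let $E,F\subset\mathbb{C}$ be closed disjoint sets such that $\sigma(A)\subseteq E$ and $\sigma(B)\subseteq F$. Suppose that the matrix $X\in\mathbb{C}^{m\times n}$ satisfies \[ AX-XB=MN^*,\qquad M\in\mathbb{C}^{m\times \nu},\quad N\in\mathbb{C}^{n\times\nu}, \] where $1\le \nu\le n$ is an integer. Then, for all integers $j\ge 1$ and $k\ge 0$ with $1\le j+\nu k\le n$, the singular values of $X$ satisfy \[ \sigma_{j+\nu k}(X)\le Z_k(E,F)\,\sigma_j(X). \]
   Context: $\sigma(A)$ denotes the spectrum (set of eigenvalues) of a square matrix $A$; $N^*$ is the conjugate transpose of $N$. For $X\in\mathbb{C}^{m\times n}$ with $m\ge n$, $\sigma_1(X)\ge\cdots\ge\sigma_n(X)\ge 0$ are its singular values. For an integer $k\ge 0$, $\mathcal{R}_{k,k}$ is the set of irreducible rational functions $p(x)/q(x)$ with $p,q$ complex polynomials of degree at most $k$. For closed disjoint sets $E,F\subset\mathbb{C}$ the Zolotarev number is \[ Z_k(E,F):=\inf_{r\in\mathcal{R}_{k,k}}\frac{\sup_{z\in E}|r(z)|}{\inf_{z\in F}|r(z)|}, \] where $|r(z)|=\infty$ at poles of $r$, and only $r$ with $\sup_{z\in E}|r(z)|<\infty$ and $\inf_{z\in F}|r(z)|>0$ need be considered (a finite number divided by $\infty$ is $0$). *)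

(* Defs.v *)
From HB Require Import structures.
From mathcomp Require Import all_boot all_order all_algebra.
From mathcomp Require Export complex.
From mathcomp Require Import classical_sets reals ereal topology normedtype.

Set Implicit Arguments.
Unset Strict Implicit.
Unset Printing Implicit Defensive.

Import Order.TTheory GRing.Theory Num.Theory numFieldNormedType.Exports.

Local Open Scope classical_set_scope.
Local Open Scope ring_scope.
Local Open Scope complex_scope.
Local Open Scope sesquilinear_scope.

(* The square roots of the n eigenvalues (with multiplicity) of X^* X, in
   nonincreasing order.  X^* X is Hermitian, so [spectral_diag] lists its
   eigenvalues, which are nonnegative reals: [Re] only changes the type. *)
Definition singular_values (R : realType) (m n : nat) (X : 'M[R[i]]_(m, n)) :
    seq R :=
  sort (fun x y : R => y <= x)
    [seq Num.sqrt (complex.Re (spectral_diag (X ^t* *m X) 0 i))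
       | i <- enum 'I_n].

(* sigma_i(X), indexed from 1: meaningful for 1 <= i <= n. *)
Definition singular_value (R : realType) (m n : nat) (X : 'M[R[i]]_(m, n))
    (i : nat) : R :=
  nth 0 (singular_values X) i.-1.

(* (p, q) represents the irreducible rational function p / q. *)
Definition in_Rkk (R : realType) (k : nat) (p q : {poly R[i]}) : Prop :=
  [/\ q != 0, coprimep p q, (size p <= k.+1)%N & (size q <= k.+1)%N].

(* |p(z) / q(z)|, infinite at the roots of q; these are the poles of p / q
   because p and q are coprime. *)
Definition rat_abs (R : realType) (p q : {poly R[i]}) (z : R[i]) : \bar R :=
  if root q z then +oo%E else (Normc.normc (p.[z] / q.[z]))%:E.

(* Z_k(E, F) for nonempty E and F (the supremum over an empty set would be -oo
   here).  The quotient is taken in \bar R, where x / +oo = 0 for finite x. *)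
Definition zolotarev (R : realType) (k : nat) (E F : set R[i]) : \bar R :=
  ereal_inf [set t : \bar R | exists p q : {poly R[i]},
    let s := ereal_sup (rat_abs p q @` E) in
    let i := ereal_inf (rat_abs p q @` F) in
    [/\ in_Rkk k p q, (s < +oo)%E, (0 < i)%E & t = (s / i)%E]].

(* Main.v *)
Require Import Defs.
From HB Require Import structures.
From mathcomp Require Import all_boot all_order all_algebra.
From mathcomp Require Import complex.
From mathcomp Require Import classical_sets reals ereal topology normedtype.
From mathcomp Require Import zify ring.

(** The bound compares X with itself through a rational function r = p / q of
    degree at most k.  Moving powers of A across X by means of
    A X - X B = M N^* leaves remainders whose rows lie in the span of the rows
    of N^*, N^* B, ..., N^* B^(k-1); hence
      W = q(A) X p(B) - p(A) X q(B)
    has rank at most nu k ([sylvester_horner_rank]).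

    Let l = j + nu k.  For a vector u put v = p(B) u and w = q(B) u.  Ask that
    W u = 0, that v lie in the span of the right singular vectors of X with
    singular values at least sigma_l, and that w lie in the span of those with
    singular values at most sigma_j.  These are at most
    nu k + (n - l) + (j - 1) = n - 1 linear conditions, so some u <> 0 meets
    all of them ([joint_kernel]).  Now W u = 0 reads q(A) (X v) = p(A) (X w),
    and q(B) v = p(B) w by construction.  In an orthonormal eigenbasis of the
    normal matrix A, the first equation gives |X v| <= s |X w| with
    s = sup_E |r|; in one of B, the second gives |w| <= |v| / i with
    i = inf_F |r| ([normal_ratio_sqnorm] serves for both).  Therefore
      sigma_l |v| <= |X v| <= s |X w| <= s sigma_j |w| <= (s / i) sigma_j |v|,
    and v <> 0 because p has no root in F, so sigma_l <= (s / i) sigma_j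
    ([rational_spectral_gap], [singular_value_rational_le]).  Since no matrix is
    inverted, the poles of r in F, where |r| is infinite, need no special
    treatment.  It remains to take the infimum over r. *)

Set Implicit Arguments.
Unset Strict Implicit.
Unset Printing Implicit Defensive.

Import Order.TTheory GRing.Theory Num.Theory numFieldNormedType.Exports.

Local Open Scope classical_set_scope.
Local Open Scope ring_scope.
Local Open Scope complex_scope.
Local Open Scope sesquilinear_scope.

(** * The rank of a Sylvester commutator *)

(** Each trade of a factor A on the left of X for a factor B on the right costs
    one term A^a M (N B^b) with b < k, whose rows are combinations of the rows
    of N B^b; it takes |i - j| trades to get from one product to the other. *)
Lemma sylvester_powers_sub (F : fieldType) m n nu (A : 'M[F]_m) (B : 'M_n)
    (X : 'M_(m, n)) (M : 'M_(m, nu)) (N : 'M_(nu, n)) (k i j : nat) :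
  A *m X - X *m B = M *m N -> (i <= k)%N -> (j <= k)%N ->
  (A ^+ i *m X *m B ^+ j - A ^+ j *m X *m B ^+ i
     <= \sum_(b < k) <<N *m B ^+ b>>)%MS.
Proof.
move=> AXB; set K := (\sum_(b < k) _)%MS.
have step a b : (b < k)%N ->
    (A ^+ a.+1 *m X *m B ^+ b - A ^+ a *m X *m B ^+ b.+1 <= K)%MS.
  move=> bk.
  have -> : A ^+ a.+1 *m X *m B ^+ b - A ^+ a *m X *m B ^+ b.+1 =
      A ^+ a *m M *m (N *m B ^+ b).
    rewrite mulmxA -(mulmxA _ M) -AXB mulmxBr mulmxBl exprSr exprS.
    by rewrite !mulmxA.
  apply: submx_trans (submxMl _ _) _.
  by apply: (sumsmx_sup (Ordinal bk)); rewrite ?genmxE.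
have shift d : forall a b, (b + d <= k)%N ->
    (A ^+ (a + d) *m X *m B ^+ b - A ^+ a *m X *m B ^+ (b + d) <= K)%MS.
  elim: d => [|d IH] a b bdk; first by rewrite !addn0 subrr sub0mx.
  rewrite -[X in (X <= _)%MS](subrKA (A ^+ (a + d) *m X *m B ^+ b.+1)).
  rewrite addmx_sub // ?addnS ?step //; first by lia.
  by rewrite -addSn; apply: IH; lia.
wlog le_ji : i j / (j <= i)%N => [wlg|].
  case: (leqP j i) => [|/ltnW] ij ik jk; first exact: wlg.
  by rewrite -eqmx_opp opprB; exact: wlg.
move=> ik jk; have := shift (i - j)%N j j.
by rewrite subnKC //; exact.
Qed.

Lemma horner_mx_sum (F : fieldType) n (A : 'M[F]_n.+1) (p : {poly F}) k :
  (size p <= k)%N -> horner_mx A p = \sum_(i < k) p`_i *: A ^+ i.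
Proof.
move=> pk; have {1}-> : p = \sum_(i < k) p`_i *: 'X^i.
  rewrite -poly_def; apply/polyP => i; rewrite coef_poly; case: ltnP => // ki.
  by rewrite nth_default // (leq_trans pk).
rewrite raddf_sum; apply: eq_bigr => i _ /=.
by rewrite horner_mxZ rmorphXn /= horner_mx_X.
Qed.

(** Bilinearity in (p, q) reduces this to pairs of monomials, for which the k
    blocks N B^b of nu rows each span all the rows involved. *)
Lemma sylvester_horner_rank (F : fieldType) m n nu (A : 'M[F]_m.+1)
    (B : 'M_n.+1) (X : 'M_(m.+1, n.+1)) (M : 'M_(m.+1, nu))
    (N : 'M_(nu, n.+1)) (k : nat) (p q : {poly F}) :
  A *m X - X *m B = M *m N -> (size p <= k.+1)%N -> (size q <= k.+1)%N ->
  (\rank (horner_mx A p *m X *m horner_mx B q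
          - horner_mx A q *m X *m horner_mx B p)%R <= nu * k)%N.
Proof.
move=> AXB pk qk.
have -> : horner_mx A p *m X *m horner_mx B q
          - horner_mx A q *m X *m horner_mx B p =
    \sum_(i < k.+1) \sum_(j < k.+1) (p`_i * q`_j) *:
      (A ^+ i *m X *m B ^+ j - A ^+ j *m X *m B ^+ i).
  rewrite !(horner_mx_sum _ pk) !(horner_mx_sum _ qk) !mulmx_suml.
  have -> : \sum_(i < k.+1) q`_i *: A ^+ i *m X *m (\sum_(j < k.+1) p`_j *: B ^+ j)
     = \sum_(i < k.+1) \sum_(j < k.+1) p`_i *: (q`_j *: (A ^+ j *m X *m B ^+ i)).
    rewrite exchange_big; apply: eq_bigr => i _; rewrite mulmx_sumr.
    apply: eq_bigr => j _.
    by rewrite -!scalemxAl -scalemxAr !scalerA mulrC.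
  rewrite -sumrB; apply: eq_bigr => i _; rewrite mulmx_sumr -sumrB.
  apply: eq_bigr => j _.
  by rewrite -!scalemxAl -scalemxAr scalerA scalerBr !scalerA.
apply: (@leq_trans (\rank (\sum_(b < k) <<N *m B ^+ b>>)%MS)).
  apply: mxrankS; apply: summx_sub => i _; apply: summx_sub => j _.
  by apply: scalemx_sub; apply: sylvester_powers_sub AXB _ _; rewrite -ltnS.
rewrite mulnC -[k in (k * nu)%N]card_ord -sum_nat_const.
elim/big_ind2: _ => [|r1 K1 r2 K2 le1 le2|b _]; first by rewrite mxrank0.
  by rewrite (leq_trans (mxrank_adds_leqif _ _).1) // leq_add.
by rewrite mxrank_gen rank_leq_row.
Qed.

(** * Common solutions of linear conditions *)

Lemma rank_lt_cols_kernel (F : fieldType) r n (K : 'M[F]_(r, n)) :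
  (\rank K < n)%N -> exists2 u : 'cV_n, u != 0 & K *m u = 0.
Proof.
move=> rkK; have: cokermx K != 0.
  by rewrite -mxrank_eq0 mxrank_coker subn_eq0 -ltnNge.
case/matrix0Pn=> i [j nz]; exists (col j (cokermx K)).
  by apply/matrix0Pn; exists i, 0; rewrite mxE.
by rewrite colE mulmxA mulmx_coker mul0mx.
Qed.

(** Fewer than n linear conditions on n unknowns have a nonzero common solution;
    here the conditions are W u = 0 and the vanishing of chosen coordinates of
    G1 u and of G2 u. *)
Lemma joint_kernel (F : fieldType) r n (W : 'M[F]_(r, n)) (G1 G2 : 'M_n)
    (S1 S2 : {set 'I_n}) :
  (#|S1| + #|S2| + \rank W < n)%N ->
  exists u : 'cV_n, [/\ u != 0, W *m u = 0,
    forall i, i \in S1 -> (G1 *m u) i 0 = 0 &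
    forall i, i \in S2 -> (G2 *m u) i 0 = 0].
Proof.
pose sel (S : {set 'I_n}) (G : 'M[F]_n) := rowsub (@enum_val _ (mem S)) G.
pose K := (sel S1 G1 + (sel S2 G2 + W))%MS.
move=> lt_n; have [|u u0 Ku] := @rank_lt_cols_kernel _ _ _ K.
  apply: leq_ltn_trans lt_n; rewrite /K -addnA.
  apply: leq_trans (mxrank_adds_leqif _ _).1 _.
  apply: leq_add; first exact: rank_leq_row.
  apply: leq_trans (mxrank_adds_leqif _ _).1 _.
  by rewrite leq_add2r rank_leq_row.
have kill r' (V : 'M_(r', n)) : (V <= K)%MS -> V *m u = 0.
  by case/submxP=> D ->; rewrite -mulmxA Ku mulmx0.
have killsel S G i : (sel S G <= K)%MS -> i \in S -> (G *m u) i 0 = 0.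
  move=> /kill /matrixP selu Si.
  have := selu (enum_rank_in Si i) 0.
  by rewrite mul_rowsub_mx !mxE enum_rankK_in // => ->.
exists u; split => //.
- by apply: kill; rewrite (submx_trans (addsmxSr _ _) (addsmxSr _ _)).
- by move=> i; apply: killsel; rewrite addsmxSl.
- move=> i; apply: killsel.
  exact: submx_trans (addsmxSl _ _) (addsmxSr _ _).
Qed.

(** * Euclidean norms and normal matrices *)

Definition sqnorm (C : numClosedFieldType) n (v : 'cV[C]_n) : C :=
  \sum_i `|v i 0| ^+ 2.

Lemma sqnorm_ge0 (C : numClosedFieldType) n (v : 'cV[C]_n) : 0 <= sqnorm v.
Proof. by apply: sumr_ge0 => i _; rewrite exprn_ge0 ?normr_ge0. Qed.

Lemma sqnorm_eq0 (C : numClosedFieldType) n (v : 'cV[C]_n) :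
  (sqnorm v == 0) = (v == 0).
Proof.
rewrite psumr_eq0 => [|i _]; last by rewrite exprn_ge0 ?normr_ge0.
apply/allP/eqP => [v0|-> i _]; last by rewrite mxE normr0 expr0n eqxx.
apply/colP => i; have := v0 i (mem_index_enum i).
by rewrite /= sqrf_eq0 normr_eq0 mxE => /eqP.
Qed.

Lemma sqnormE (C : numClosedFieldType) n (v : 'cV[C]_n) :
  sqnorm v = (v ^t* *m v) 0 0.
Proof. by rewrite mxE; apply: eq_bigr => i _; rewrite !mxE normCKC. Qed.

Lemma adjointM (C : numClosedFieldType) m n p (A : 'M[C]_(m, n)) (B : 'M_(n, p)) :
  (A *m B) ^t* = B ^t* *m A ^t*.
Proof. by rewrite trmx_mul map_mxM. Qed.

Lemma sqnorm_unitary (C : numClosedFieldType) n (P : 'M[C]_n) (v : 'cV_n) :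
  P \is unitarymx -> sqnorm (P *m v) = sqnorm v.
Proof.
move=> uP; rewrite !sqnormE adjointM -mulmxA -invmx_unitary //.
by rewrite mulKmx // unitarymx_unit.
Qed.

Lemma hermitian_gram (C : numClosedFieldType) m n (X : 'M[C]_(m, n)) :
  X ^t* *m X \is hermsymmx.
Proof.
by apply/is_hermitianmxP; rewrite expr0 scale1r adjointM trmxCK.
Qed.

(** The rows of P are the conjugated right singular vectors of X and d lists the
    squared singular values: this is the diagonal form of v |-> |X v|^2. *)
Lemma sqnorm_mulmx_gram (C : numClosedFieldType) m n (X : 'M[C]_(m, n))
    (v : 'cV_n) (P := spectralmx (X ^t* *m X)) (d := spectral_diag (X ^t* *m X)) :
  sqnorm (X *m v) = \sum_i d 0 i * `|(P *m v) i 0| ^+ 2.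
Proof.
rewrite sqnormE adjointM mulmxA -(mulmxA _ _ X).
have /orthomx_spectralP -> := hermitian_normalmx (hermitian_gram X).
rewrite -/P -/d invmx_unitary ?spectral_unitarymx // !mulmxA.
rewrite -adjointM -(mulmxA _ P) mxE; apply: eq_bigr => i _.
by rewrite mul_mx_diag !mxE normCKC mulrA [d 0 i * _]mulrC.
Qed.

Lemma gram_spectral_diag_ge0 (C : numClosedFieldType) m n (X : 'M[C]_(m, n)) i :
  0 <= spectral_diag (X ^t* *m X) 0 i.
Proof.
set P := spectralmx (X ^t* *m X).
(* Evaluate the quadratic form |X v|^2 at the i-th eigenvector of X^* X. *)
have := sqnorm_ge0 (X *m (invmx P *m delta_mx i 0)).
rewrite sqnorm_mulmx_gram mulKVmx ?spectral_unit // (bigD1 i) //=.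
rewrite big1 => [|j ji]; first by rewrite mxE !eqxx normr1 expr1n mulr1 addr0.
by rewrite mxE (negPf ji) normr0 expr0n mulr0.
Qed.

Lemma spectral_diag_eigenvalue (C : numClosedFieldType) n (A : 'M[C]_n) i :
  A \is normalmx -> eigenvalue A (spectral_diag A 0 i).
Proof.
move=> /orthomx_spectralP; set P := spectralmx A; set d := spectral_diag A.
move=> eqA; apply/eigenvalueP; exists (row i P).
  rewrite -row_mul {1}eqA !mulmxA mulmxV ?spectral_unit // mul1mx row_mul.
  by rewrite row_diag_mx -scalemxAl -rowE.
have := spectral_unit A; rewrite -row_free_unit -/P => /row_freeP[Q PQ].
apply/eqP => Pi; have := congr1 (row i) PQ.
rewrite row_mul Pi mul0mx => /rowP/(_ i).
by rewrite !mxE eqxx => /esym/eqP; rewrite oner_eq0.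
Qed.

Lemma spectral_horner_mx (C : numClosedFieldType) n (A : 'M[C]_n.+1)
    (p : {poly C}) (v : 'cV_n.+1) i : A \is normalmx ->
  (spectralmx A *m (horner_mx A p *m v)) i 0 =
    p.[spectral_diag A 0 i] * (spectralmx A *m v) i 0.
Proof.
move=> /orthomx_spectralP eqA; have uP := spectral_unit A.
rewrite {2}eqA horner_mx_uconjC // horner_mx_diag !mulmxA mulmxV // mul1mx.
by rewrite -mulmxA mul_diag_mx !mxE.
Qed.

(** Formally y = (p / q)(A) z, so that this bounds the norm of a rational
    function of a normal matrix by its values on the spectrum.  Stated without
    an inverse, it also applies to q / p and B, to bound w by v. *)
Lemma normal_ratio_sqnorm (C : numClosedFieldType) n (A : 'M[C]_n.+1)
    (p q : {poly C}) (c : C) (y z : 'cV_n.+1) :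
  A \is normalmx -> 0 <= c ->
  (forall a, eigenvalue A a -> q.[a] != 0) ->
  (forall a, eigenvalue A a -> `|p.[a]| <= c * `|q.[a]|) ->
  horner_mx A q *m y = horner_mx A p *m z ->
  sqnorm y <= c ^+ 2 * sqnorm z.
Proof.
move=> nA c0 q0 pq yz; have uP := spectral_unitarymx A.
rewrite -(sqnorm_unitary y uP) -(sqnorm_unitary z uP) /sqnorm mulr_sumr.
apply: ler_sum => i _; rewrite -exprMn lerXn2r ?nnegrE ?mulr_ge0 //.
have eig := spectral_diag_eigenvalue i nA.
have qi : 0 < `|q.[spectral_diag A 0 i]| by rewrite normr_gt0 q0.
rewrite -(ler_pM2l qi) -normrM -spectral_horner_mx // yz.
by rewrite spectral_horner_mx // normrM mulrA ler_wpM2r // mulrC pq.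
Qed.

Lemma horner_mx_normal_inj (C : numClosedFieldType) n (A : 'M[C]_n.+1)
    (p : {poly C}) (v : 'cV_n.+1) :
  A \is normalmx -> (forall a, eigenvalue A a -> p.[a] != 0) ->
  horner_mx A p *m v = 0 -> v = 0.
Proof.
move=> nA p0 pv; rewrite -[v](mulKmx (spectral_unit A)).
suff -> : spectralmx A *m v = 0 by rewrite mulmx0.
apply/colP => i; have := spectral_horner_mx p v i nA.
rewrite pv mulmx0 mxE => /esym/eqP.
by rewrite mulf_eq0 (negPf (p0 _ (spectral_diag_eigenvalue i nA))) mxE => /eqP.
Qed.

(** * Quadratic forms and rational functions *)

(** The core of the argument, for thresholds x and y on the squared singular
    values: a vector u as in the introduction exists as soon as the singular
    directions to be avoided and the rank nu k do not fill the whole space. *)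
Lemma rational_spectral_gap (C : numClosedFieldType) m n nu
    (A : 'M[C]_m.+1) (B : 'M_n.+1) (X : 'M_(m.+1, n.+1))
    (M : 'M_(m.+1, nu)) (N : 'M_(nu, n.+1)) (k : nat) (p q : {poly C})
    (s t x y : C) (d := spectral_diag (X ^t* *m X)) :
  A \is normalmx -> B \is normalmx -> A *m X - X *m B = M *m N ->
  (size p <= k.+1)%N -> (size q <= k.+1)%N ->
  (forall a, eigenvalue A a -> q.[a] != 0) ->
  (forall b, eigenvalue B b -> p.[b] != 0) ->
  (forall a, eigenvalue A a -> `|p.[a]| <= s * `|q.[a]|) ->
  (forall b, eigenvalue B b -> `|q.[b]| <= t * `|p.[b]|) ->
  0 <= s -> 0 <= t -> 0 <= y ->
  (#|[set i | ~~ (x <= d 0 i)%R]%SET| + #|[set i | ~~ (d 0 i <= y)%R]%SET| + nu * k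
     < n.+1)%N ->
  x <= (s * t) ^+ 2 * y.
Proof.
move=> nA nB AXB pk qk qA pB sA tB s0 t0 y0 gap.
set P := spectralmx (X ^t* *m X).
set W := horner_mx A q *m X *m horner_mx B p
         - horner_mx A p *m X *m horner_mx B q.
have [|u [u0 Wu low high]] := @joint_kernel _ _ _ W
    (P *m horner_mx B p) (P *m horner_mx B q)
    [set i | ~~ (x <= d 0 i)]%SET [set i | ~~ (d 0 i <= y)]%SET.
  by apply: leq_ltn_trans gap; rewrite leq_add2l (sylvester_horner_rank AXB).
(* v has no component along the singular directions with d i < x, and w none
   along those with d i > y. *)
set v := horner_mx B p *m u; set w := horner_mx B q *m u.
have uP : P \is unitarymx := spectral_unitarymx _.
have v_gt0 : 0 < sqnorm v.
  rewrite lt_def sqnorm_ge0 sqnorm_eq0 andbT.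
  by apply: contraNneq u0 => /(horner_mx_normal_inj nB pB) ->.
have xv : x * sqnorm v <= sqnorm (X *m v).
  rewrite sqnorm_mulmx_gram -(sqnorm_unitary v uP) mulr_sumr.
  apply: ler_sum => i _; have [xd|xd] := boolP (x <= d 0 i).
    by rewrite ler_wpM2r ?exprn_ge0 ?normr_ge0.
  by rewrite mulmxA low ?inE // normr0 expr0n !mulr0.
have wy : sqnorm (X *m w) <= y * sqnorm w.
  rewrite sqnorm_mulmx_gram -(sqnorm_unitary w uP) mulr_sumr.
  apply: ler_sum => i _; have [dy|dy] := boolP (d 0 i <= y).
    by rewrite ler_wpM2r ?exprn_ge0 ?normr_ge0.
  by rewrite mulmxA high ?inE // normr0 expr0n !mulr0.
have vw : sqnorm (X *m v) <= s ^+ 2 * sqnorm (X *m w).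
  apply: (normal_ratio_sqnorm nA s0 qA sA).
  by apply/eqP; rewrite -subr_eq0 !mulmxA -mulmxBl Wu.
have wv : sqnorm w <= t ^+ 2 * sqnorm v.
  apply: (normal_ratio_sqnorm nB t0 pB tB).
  by rewrite !mulmxA; congr (_ *m u); exact: comm_horner_mx2.
rewrite -(ler_pM2r v_gt0) (le_trans xv) // (le_trans vw) //.
have -> : (s * t) ^+ 2 * y * sqnorm v = s ^+ 2 * (y * (t ^+ 2 * sqnorm v)).
  by ring.
apply: ler_wpM2l; first exact: exprn_ge0.
by apply: le_trans wy _; rewrite ler_wpM2l.
Qed.

(** * Sorted singular values *)

Lemma size_singular_values (R : realType) m n (X : 'M[R[i]]_(m, n)) :
  size (singular_values X) = n.
Proof. by rewrite size_sort size_map size_enum_ord. Qed.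

(** Only entries placed strictly after position i in the decreasing order can be
    smaller than the entry at position i. *)
Lemma count_lt_nth_sort_ge (R : realDomainType) (s : seq R) i :
  (i < size s)%N ->
  (count (fun z => z < nth 0%R (sort (>=%R) s) i)%R s + i < size s)%N.
Proof.
move=> i_s; set t := sort _ s; have pst : perm_eq t s := permEl (perm_sort _ s).
have st : sorted >=%R t by apply: sort_sorted => a b; exact: le_total.
rewrite -(perm_size pst) -(permP pst); rewrite -(perm_size pst) in i_s.
rewrite -[X in count _ X](cat_take_drop i.+1 t) count_cat.
have -> : count (fun z => z < nth 0 t i) (take i.+1 t) = 0%N.
  apply/eqP; rewrite -leqn0 leqNgt -has_count; apply/hasPn => z.
  case/(nthP 0) => l; rewrite size_takel // => li <-.
  rewrite nth_take // -leNgt; apply: (sorted_leq_nth ge_trans ge_refl) => //.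
  by rewrite inE (leq_trans li).
rewrite add0n; apply: leq_ltn_trans (leq_add (count_size _ _) (leqnn i)) _.
by rewrite size_drop; lia.
Qed.

Lemma count_gt_nth_sort_ge (R : realDomainType) (s : seq R) i :
  (i < size s)%N ->
  (count (fun z => nth 0%R (sort (>=%R) s) i < z)%R s <= i)%N.
Proof.
move=> i_s; set t := sort _ s; have pst : perm_eq t s := permEl (perm_sort _ s).
have st : sorted >=%R t by apply: sort_sorted => a b; exact: le_total.
rewrite -(permP pst); rewrite -(perm_size pst) in i_s.
rewrite -[X in count _ X](cat_take_drop i t) count_cat.
have -> : count (fun z => nth 0 t i < z) (drop i t) = 0%N.
  apply/eqP; rewrite -leqn0 leqNgt -has_count; apply/hasPn => z.
  case/(nthP 0) => l; rewrite size_drop => li <-.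
  rewrite nth_drop -leNgt; apply: (sorted_leq_nth ge_trans ge_refl) => //.
    by rewrite inE -ltn_subRL.
  exact: leq_addr.
by rewrite addn0 (leq_trans (count_size _ _)) // size_take; case: ifP => //; lia.
Qed.

(** The singular values in the order of [spectral_diag] rather than sorted, so
    that each of them remains attached to its singular vector. *)
Definition gram_sqrt (R : realType) m n (X : 'M[R[i]]_(m, n)) (i : 'I_n) : R :=
  Num.sqrt (complex.Re (spectral_diag (X ^t* *m X) 0 i)).

Lemma gram_sqrtE (R : realType) m n (X : 'M[R[i]]_(m, n)) i :
  spectral_diag (X ^t* *m X) 0 i = (gram_sqrt X i ^+ 2)%:C.
Proof.
have := gram_spectral_diag_ge0 X i; rewrite /gram_sqrt.
case: (spectral_diag _ 0 i) => a b; rewrite lecE /= => /andP[/eqP b0 a0].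
by rewrite sqr_sqrtr // b0.
Qed.

Lemma singular_value_ge0 (R : realType) m n (X : 'M[R[i]]_(m, n)) i :
  0 <= singular_value X i.
Proof.
have [ni|ni] := leqP n i.-1.
  by rewrite /singular_value nth_default // size_singular_values.
have : singular_value X i \in singular_values X.
  by rewrite mem_nth // size_singular_values.
by rewrite mem_sort => /mapP[l _ ->]; exact: sqrtr_ge0.
Qed.

Lemma card_gram_sqrt (R : realType) m n (X : 'M[R[i]]_(m, n)) (a : pred R) :
  #|[set i | a (gram_sqrt X i)]%SET|
    = count a [seq gram_sqrt X l | l <- enum 'I_n].
Proof. by rewrite count_map cardsE cardE enumT /enum_mem size_filter. Qed.

(** The thresholds are sigma_l^2 and sigma_j^2 with l = j + nu k: at most
    (n.+1 - l) + (j - 1) singular directions are excluded, which with the rank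
    nu k makes n. *)
Lemma singular_value_rational_le (R : realType) m n nu
    (A : 'M[R[i]]_m.+1) (B : 'M_n.+1) (X : 'M_(m.+1, n.+1))
    (M : 'M_(m.+1, nu)) (N : 'M_(nu, n.+1)) (j k : nat) (p q : {poly R[i]})
    (s t : R) :
  A \is normalmx -> B \is normalmx -> A *m X - X *m B = M *m N ->
  (size p <= k.+1)%N -> (size q <= k.+1)%N ->
  (forall a, eigenvalue A a -> q.[a] != 0) ->
  (forall b, eigenvalue B b -> p.[b] != 0) ->
  (forall a, eigenvalue A a -> Normc.normc p.[a] <= s * Normc.normc q.[a]) ->
  (forall b, eigenvalue B b -> Normc.normc q.[b] <= t * Normc.normc p.[b]) ->
  0 <= s -> 0 <= t -> (1 <= j)%N -> (j + nu * k <= n.+1)%N ->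
  singular_value X (j + nu * k) <= s * t * singular_value X j.
Proof.
move=> nA nB AXB pk qk qA pB sA tB s0 t0 j1 jn.
set x := singular_value X (j + nu * k); set y := singular_value X j.
have x0 : 0 <= x := singular_value_ge0 _ _.
have y0 : 0 <= y := singular_value_ge0 _ _.
rewrite -(@ler_pXn2r _ 2) ?nnegrE ?mulr_ge0 // [leRHS]exprMn.
rewrite -lecR.
have -> : ((s * t) ^+ 2 * y ^+ 2)%:C = (s%:C * t%:C) ^+ 2 * (y ^+ 2)%:C.
  by rewrite -rmorphM -rmorphXn -rmorphM.
apply: (rational_spectral_gap nA nB AXB pk qk qA pB) => [a /sA|b /tB||||].
- by rewrite -lecR rmorphM.
- by rewrite -lecR rmorphM.
- by rewrite lecR.
- by rewrite lecR.
- by rewrite lecR exprn_ge0.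
have -> : [set i | ~~ ((x ^+ 2)%:C <= spectral_diag (X ^t* *m X) 0 i)%R]%SET
    = [set i | (gram_sqrt X i < x)%R]%SET.
  apply/setP => i; rewrite !inE gram_sqrtE lecR.
  by rewrite ler_pXn2r ?nnegrE ?sqrtr_ge0 // ltNge.
have -> : [set i | ~~ (spectral_diag (X ^t* *m X) 0 i <= (y ^+ 2)%:C)%R]%SET
    = [set i | (y < gram_sqrt X i)%R]%SET.
  apply/setP => i; rewrite !inE gram_sqrtE lecR.
  by rewrite ler_pXn2r ?nnegrE ?sqrtr_ge0 // ltNge.
rewrite (card_gram_sqrt X (fun z => z < x)) (card_gram_sqrt X (fun z => y < z)).
set sv := [seq gram_sqrt X l | l <- enum 'I_n.+1].
have size_sv : size sv = n.+1 by rewrite size_map size_enum_ord.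
have lo : (count (fun z => z < x)%R sv + (j + nu * k).-1 < n.+1)%N.
  by rewrite -[ltnRHS]size_sv; apply: count_lt_nth_sort_ge; rewrite size_sv; lia.
have hi : (count (fun z => y < z)%R sv <= j.-1)%N.
  by apply: count_gt_nth_sort_ge; rewrite size_sv; lia.
move: (count _ _) (count _ _) lo hi => c1 c2; lia.
Qed.

(** * The Zolotarev infimum *)

(** Turns a quotient occurring in the Zolotarev infimum into two real constants
    s' and t and inequalities free of division, with t = 0 when p / q is
    infinite on all of F.  At a pole in F the bounds hold because q vanishes,
    and p does not, by coprimality. *)
Lemma zolotarev_ratio (R : realType) (E F : set R[i])
    (p q : {poly R[i]})
    (s := ereal_sup (rat_abs p q @` E)) (i := ereal_inf (rat_abs p q @` F)) :
  E !=set0 -> coprimep p q -> (s < +oo)%E -> (0 < i)%E ->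
  exists2 s' : R, 0 <= s' & exists2 t : R, 0 <= t & [/\
    (s / i)%E = (s' * t)%:E,
    forall a, E a -> q.[a] != 0,
    forall b, F b -> p.[b] != 0,
    forall a, E a -> Normc.normc p.[a] <= s' * Normc.normc q.[a] &
    forall b, F b -> Normc.normc q.[b] <= t * Normc.normc p.[b]].
Proof.
move=> [a0 Ea0] pq soo i0.
have rat_le_s a : E a -> (rat_abs p q a <= s)%E.
  by move=> Ea; apply: ereal_sup_ubound; exists a.
have i_le_rat b : F b -> (i <= rat_abs p q b)%E.
  by move=> Fb; apply: ereal_inf_lbound; exists b.
have normc_ge0 (z : R[i]) : 0 <= Normc.normc z by case: z => ? ?; exact: sqrtr_ge0.
have normc_eq0 (z : R[i]) : (Normc.normc z == 0) = (z == 0).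
  by apply/eqP/eqP => [/Normc.eq0_normc //|->]; exact: Normc.normc0.
have normc_gt0 (z : R[i]) : z != 0 -> 0 < Normc.normc z.
  by move=> z0; rewrite lt_def normc_eq0 z0 normc_ge0.
have nroot_E a : E a -> q.[a] != 0.
  move=> /rat_le_s; rewrite /rat_abs rootE; case: ifP => // _.
  by rewrite leye_eq => /eqP soo'; rewrite soo' in soo.
have s_ge0 : (0 <= s)%E.
  apply: le_trans (rat_le_s _ Ea0).
  by rewrite /rat_abs; case: ifP => _; rewrite ?leey // lee_fin.
have {soo s_ge0} [s' s'E s'0] : exists2 s' : R, s = s'%:E & 0 <= s'.
  by move: s soo s_ge0 {rat_le_s} => [r| |] //= _ r0; exists r; rewrite -?lee_fin.
have nroot_F b : F b -> p.[b] != 0.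
  move=> /i_le_rat; rewrite /rat_abs; case: ifP => [qb _|_ ib].
    apply/negP => pb; have := coprimep_root pq pb.
    by rewrite (rootP qb) eqxx.
  apply/negP => /eqP pb; move: ib; rewrite pb mul0r Normc.normc0.
  by rewrite leNgt i0.
have [t t0 [tE tF]] : exists2 t : R, 0 <= t & i^-1%E = t%:E /\
    forall b, F b -> Normc.normc q.[b] <= t * Normc.normc p.[b].
  move: i i0 i_le_rat => [r| |] //= r0 i_le.
  - exists r^-1; first by rewrite invr_ge0 ltW.
    rewrite lte_fin in r0.
    split=> [|b Fb]; first by rewrite inver gt_eqF.
    move: (i_le b Fb); rewrite /rat_abs rootE; case: eqP => [-> _|/eqP qb].
      by rewrite Normc.normc0 mulr_ge0 // invr_ge0 ltW.
    rewrite lee_fin Normc.normcM Normc.normcV ler_pdivlMr ?normc_gt0 // => le.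
    by rewrite ler_pdivlMl.
  - exists 0 => //; split=> [|b Fb]; first by rewrite invey.
    move: (i_le b Fb); rewrite /rat_abs rootE; case: eqP => [-> _|_].
      by rewrite Normc.normc0 mul0r.
    by rewrite leye_eq.
exists s' => //; exists t => //; split => //; first by rewrite s'E tE.
move=> a Ea; move: (rat_le_s a Ea).
rewrite /rat_abs rootE (negPf (nroot_E a Ea)) s'E lee_fin.
by rewrite Normc.normcM Normc.normcV ler_pdivrMr // normc_gt0 // nroot_E.
Qed.

Theorem theorem2p1 (R : realType) (m n nu : nat)
    (A : 'M[R[i]]_m) (B : 'M[R[i]]_n) (E F : set R[i])
    (X : 'M[R[i]]_(m, n)) (M : 'M[R[i]]_(m, nu)) (N : 'M[R[i]]_(n, nu)) :
  (1 <= n)%N -> (n <= m)%N ->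
  A \is normalmx -> B \is normalmx ->
  closed (E : set R[i]^o) -> closed (F : set R[i]^o) -> E `&` F = set0 ->
  (forall a : R[i], eigenvalue A a -> E a) ->
  (forall b : R[i], eigenvalue B b -> F b) ->
  (1 <= nu <= n)%N ->
  A *m X - X *m B = M *m N ^t* ->
  forall j k : nat, (1 <= j)%N -> (1 <= j + nu * k <= n)%N ->
  ((singular_value X (j + nu * k))%:E
     <= zolotarev k E F * (singular_value X j)%:E)%E.
Proof.
case: n B X N => // n B X N _; case: m A X M => // m A X M _.
move=> nA nB _ _ _ AE BF _ AXB j k j1 /andP[_ jn].
have E0 : E !=set0 by have [a /AE] := eigenvalue_closed A isT; exists a.
have bound z : (exists p q : {poly R[i]},
    let s := ereal_sup (rat_abs p q @` E) in
    let i := ereal_inf (rat_abs p q @` F) in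
    [/\ in_Rkk k p q, (s < +oo)%E, (0 < i)%E & z = (s / i)%E]) ->
    exists2 c : R, z = c%:E &
      singular_value X (j + nu * k) <= c * singular_value X j.
  move=> [p [q [[_ pq pk qk] soo i0 ->]]].
  have [s s0 [t t0 [-> qE pF sE tF]]] := zolotarev_ratio E0 pq soo i0.
  exists (s * t) => //.
  apply: (singular_value_rational_le nA nB AXB pk qk) => // a.
  - by move/AE; exact: qE.
  - by move/BF; exact: pF.
  - by move/AE; exact: sE.
  - by move/BF; exact: tF.
set x := singular_value X _; set y := singular_value X j in bound *.
have x0 : 0 <= x := singular_value_ge0 _ _.
have : 0 <= y := singular_value_ge0 _ _.
rewrite le_eqVlt => /predU1P[y0|y0].
  (* Dividing by sigma_j is impossible here, but p = q = 1 already shows that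
     the singular values decrease. *)
  rewrite -y0 mule0 lee_fin.
  have := @singular_value_rational_le _ _ _ _ A B X M (N ^t*) j k 1 1 1 1 nA nB AXB.
  rewrite -/x -/y -y0 mulr0; apply; rewrite ?size_poly1 // => a _.
  - by rewrite hornerC oner_eq0.
  - by rewrite hornerC oner_eq0.
  - by rewrite mul1r.
  - by rewrite mul1r.
have xZ : ((x / y)%:E <= zolotarev k E F)%E.
  apply/ereal_infP => z /bound[c -> xc].
  by rewrite lee_fin ler_pdivrMr.
have -> : x%:E = ((x / y)%:E * y%:E)%E by rewrite -EFinM divfK // gt_eqF.
by apply: lee_wpmul2r => //; rewrite lee_fin ltW.
Qed.
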